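(* Let $F$ be a number field with ring of integers $\mathcal{O}$ and let $\mathfrak{q}\mid2$ be a prime ideal of $\mathcal{O}$. Let $v_{\mathfrak{q}}$ be the normalized valuation on $F_{\mathfrak{q}}$ and set $e=v_{\mathfrak{q}}(2)$. Then there exist an integer $n$ with $2\le n\le2e+1$, a primitive quadratic character $$\chi_{\mathfrak{q}}:(\mathcal{O}/\mathfrak{q}^n)^\times\to\{\pm1\},$$ extended by $0$ to $\mathcal{O}/\mathfrak{q}^n$, and a sign $\varepsilon\in\{\pm1\}$ such that, for every $\xi\in\tfrac12\mathcal{O}$, $$\chi_{\mathfrak{q}}(2\xi)=\varepsilon\quad\Longrightarrow\quad\mathfrak{q}\text{ ramifies in }F(\sqrt{-2\xi})/F.$$ Moreover, if $a_0\in\mathcal{O}$ is a $\mathfrak{q}$-adic unit and $\mathfrak{q}$ ramifies in $F(\sqrt{-a_0})/F$, then $n$, $\chi_{\mathfrak{q}}$ and $\varepsilon$ may be chosen so that in addition $\chi_{\mathfrak{q}}(a_0)=\varepsilon$.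
   Context: A character of $(\mathcal{O}/\mathfrak{q}^n)^\times$ is primitive if it does not factor through $(\mathcal{O}/\mathfrak{q}^m)^\times$ for any $0\le m<n$; quadratic means of order $2$. *)

(* Defs.v *)
From HB Require Import structures.
From mathcomp Require Import all_boot all_order all_algebra all_field.
From mathcomp Require Import ring_quotient.
From mathcomp Require Import boolp classical_sets.

Set Implicit Arguments.
Unset Strict Implicit.
Unset Printing Implicit Defensive.

Import GRing.Theory Num.Theory.

Local Open Scope classical_set_scope.
Local Open Scope ring_scope.

(* The ring of integers of K, as a subring type of K; only the case where K  *)
(* is a number field is used. The boolean predicate is classical.            *)
Section RingOfIntegers.
Variable K : fieldType.

Definition integral_elt : {pred K} :=
  fun x => `[< integralOver (intr : int -> K) x >].

Fact integral_elt_subring : subring_closed integral_elt.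
Proof.
split=> [|x y /asboolP xI /asboolP yI|x y /asboolP xI /asboolP yI].
- by apply/asboolP; exact: integral1.
- by apply/asboolP; exact: integral_sub.
- by apply/asboolP; exact: integral_mul.
Qed.

HB.instance Definition _ :=
  GRing.isSubringClosed.Build K integral_elt integral_elt_subring.

Record ring_of_integers :=
  RingOfIntegers { int_val :> K; int_valP : int_val \in integral_elt }.

HB.instance Definition _ := [isSub for int_val].
HB.instance Definition _ := [Choice of ring_of_integers by <:].
HB.instance Definition _ := [SubChoice_isSubComNzRing of ring_of_integers by <:].

End RingOfIntegers.

Notation "''O_' K" := (ring_of_integers K)
  (at level 8, K at level 2, format "''O_' K") : type_scope.

Section Ideals.
Variable R : comNzRingType.
Implicit Types (A I J : set R) (p : prime_idealr R).

Definition ideal_span A : set R :=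
  [set x | exists s : seq (R * R),
     (forall c, c \in s -> A c.2) /\ x = \sum_(c <- s) c.1 * c.2].

Definition ideal_mul I J : set R :=
  [set x | exists s : seq (R * R),
     (forall c, c \in s -> I c.1 /\ J c.2) /\ x = \sum_(c <- s) c.1 * c.2].

Definition ideal_pow I (n : nat) : set R := iter n (ideal_mul I) setT.

(* The exponent of p in I is k, stated for R Dedekind and I nonzero, where    *)
(* p ^ k divides I if and only if p ^ k contains I.                          *)
Definition ideal_exponent p I (k : nat) : Prop :=
  I `<=` ideal_pow [set` p] k /\ ~ I `<=` ideal_pow [set` p] k.+1.

Definition unit_mod I (x : R) : Prop := exists y, I (x * y - 1).

(* A character (R / I)^* -> {1, -1}, extended by 0 to R / I and inflated to   *)
(* a function on R. The quotients of ring_quotient are not used because they *)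
(* exclude R / R, whose trivial unit group is needed in primitive_char.      *)
Definition sign_char I (chi : R -> int) : Prop :=
  [/\ forall x y, I (x - y) -> chi x = chi y,
      forall x, ~ unit_mod I x -> chi x = 0,
      forall x, unit_mod I x -> chi x = 1 \/ chi x = -1
    & forall x y, unit_mod I x -> unit_mod I y -> chi (x * y) = chi x * chi y].

(* Characters with values in {1, -1} have order at most 2. *)
Definition quadratic_char I (chi : R -> int) : Prop :=
  sign_char I chi /\ exists2 x, unit_mod I x & chi x != 1.

Definition factors_through I J (chi : R -> int) : Prop :=
  exists2 psi, sign_char J psi & forall x, unit_mod I x -> chi x = psi x.

Definition primitive_char p (n : nat) (chi : R -> int) : Prop :=
  forall m, (m < n)%N ->
    ~ factors_through (ideal_pow [set` p] n) (ideal_pow [set` p] m) chi.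

End Ideals.

Section Valuation.
Variables (F : fieldExtType rat) (q : prime_idealr 'O_F).

Definition has_val (x : F) (k : int) : Prop :=
  exists a b : 'O_F, exists i j : nat,
    [/\ x * int_val b = int_val a,
        ideal_exponent q (ideal_span [set a]) i,
        ideal_exponent q (ideal_span [set b]) j
      & k = i%:Z - j%:Z].

(* The restriction to F of the normalized valuation of the completion F_q.   *)
(* The value at 0, which should be infinite, is a junk value.                *)
Definition val_q (x : F) : int := xget 0 [set k | has_val x k].

Definition q_adic_unit (x : F) : Prop := x != 0 /\ val_q x = 0.

End Valuation.

Section Ramification.
Variables (F : fieldExtType rat).

Section Extension.
Variable L : fieldExtType F.

Fact integral_elt_ext (x : 'O_F) : (int_val x)%:A \in @integral_elt L.
Proof.
apply/asboolP; have /asboolP[p p_mon px0] := int_valP x.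
exists p => //.
have -> : map_poly (intr : int -> L) p
        = map_poly (in_alg L) (map_poly (intr : int -> F) p).
  rewrite -map_poly_comp; apply: eq_map_poly => n.
  by rewrite /= scaler_int.
rewrite -[_%:A]/(in_alg L _) /root horner_map fmorph_eq0; exact: px0.
Qed.

Definition int_ext (x : 'O_F) : 'O_L := RingOfIntegers (integral_elt_ext x).

Definition lies_over (P : prime_idealr 'O_L) (q : prime_idealr 'O_F) : Prop :=
  forall x : 'O_F, (int_ext x \in P) = (x \in q).

Definition ext_ideal (q : prime_idealr 'O_F) : set 'O_L :=
  ideal_span (int_ext @` [set` q]).

(* Residue fields are finite, hence perfect, so that only the ramification   *)
(* indices matter.                                                           *)
Definition ramifies_in (q : prime_idealr 'O_F) : Prop :=
  exists (P : prime_idealr 'O_L) (e : nat),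
    [/\ lies_over P q, ideal_exponent P (ext_ideal q) e & (1 < e)%N].

(* L = F(sqrt d); L = F when d is a square. *)
Definition sqrt_ext (d : F) : Prop :=
  exists2 s : L, s ^+ 2 = d%:A & <<1; s>>%VS = {:L}%VS.

End Extension.

(* The extension F(sqrt d) is unique up to isomorphism. *)
Definition ramifies_in_sqrt (q : prime_idealr 'O_F) (d : F) : Prop :=
  exists L : fieldExtType F, sqrt_ext L d /\ ramifies_in L q.

End Ramification.

(* Main.v *)
Require Import Defs.
From HB Require Import structures.
From mathcomp Require Import all_boot all_order all_algebra all_field.
From mathcomp Require Import ring_quotient.
From mathcomp Require Import boolp classical_sets.
From mathcomp Require Import zify ring.

Set Implicit Arguments.
Unset Strict Implicit.
Unset Printing Implicit Defensive.

Import GRing.Theory Num.Theory.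

Local Open Scope classical_set_scope.
Local Open Scope ring_scope.

(** Let [e] be the valuation of 2 at [q].  The theorem reduces to one local
    criterion: for an integer [d] outside [q], the ideal [q] ramifies in
    [F(sqrt d)] if and only if [d] is not a square modulo [q ^+ (2 * e)].

    If [d] is not a square modulo [q ^+ (2 * e)], an approximation [x] of the
    square root that is as good as possible has [d - x ^+ 2] of odd valuation
    [2 * j + 1 < 2 * e] ([nonsquare_exponent]), and [sqrt d - x] divided by the
    [j]-th power of a uniformiser satisfies an Eisenstein equation
    ([nonsquare_ramifies]).  Conversely, if [d] is congruent to [x ^+ 2], then
    [sqrt d - x] divided by the [e]-th power of a uniformiser satisfies an
    equation that is separable modulo [q] ([square_unramified]).

    Given a class [g] of units that is not a square modulo [q ^+ (2 * e)], a
    maximal subgroup that contains the squares and avoids [g] has index 2, hence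
    is the kernel of a quadratic character taking the value -1 at [g]
    ([sign_char_separates]).  Its conductor [q ^+ n] satisfies
    [2 <= n <= 2 * e], because all classes modulo [q] are squares
    ([primitive_char_separates]).  For the corresponding primitive character
    [chi] and [eps := - chi (-1)], the equation [chi y = eps] means
    [chi (- y) = -1], so [- y] is not a square modulo [q ^+ n], and [q]
    ramifies in [F(sqrt (- y))].  The first assertion follows by taking for [g]
    a unit congruent to 1 modulo [q] but not a square modulo the square of [q],
    the second one by taking [g = - a0].

    The local theory at [q] is derived from the finiteness of the integers modulo
    2 ([finite_mod2]) by the pigeonhole principle, without Dedekind domains: it
    gives the maximality of [q], the perfection of the residue field, complete
    integral closure, and an inverse [tau] of a uniformiser
    ([uniformizing_exists]).  Multiplication by the powers of [tau] then
    describes the powers of [q] ([ideal_powP]). *)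

(** * Powers of a prime ideal *)

Section IdealPow.
Variables (R : comNzRingType) (p : prime_idealr R).
Implicit Types (i j k : nat) (x y a s : R).
Local Notation pw := (ideal_pow [set` p]).

Lemma ideal_mul_ind (I J X : set R) :
  X 0 -> (forall x y, X x -> X y -> X (x + y)) ->
  (forall x y, I x -> J y -> X (x * y)) -> ideal_mul I J `<=` X.
Proof.
move=> X0 XD XM _ [s [sIJ ->]]; elim: s sIJ => [|c s IHs] sIJ.
  by rewrite big_nil.
rewrite big_cons; apply: XD.
  by have [Ic Jc] := sIJ c (mem_head _ _); apply: XM.
by apply: IHs => d sd; apply: sIJ; rewrite inE sd orbT.
Qed.

Lemma ideal_powM1 k x y : x \in p -> pw k y -> pw k.+1 (x * y).
Proof.
move=> px py; exists [:: (x, y)]; split; last by rewrite big_seq1.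
by move=> c; rewrite inE => /eqP->.
Qed.

Lemma ideal_powS_ind k (X : set R) :
  X 0 -> (forall x y, X x -> X y -> X (x + y)) ->
  (forall x y, x \in p -> pw k y -> X (x * y)) -> pw k.+1 `<=` X.
Proof. exact: ideal_mul_ind. Qed.

Lemma ideal_pow_zero k : pw k 0.
Proof. by case: k => // k; exists [::]; rewrite big_nil. Qed.

Lemma ideal_powD k x y : pw k x -> pw k y -> pw k (x + y).
Proof.
case: k => // k [s [sI ->]] [t [tI ->]]; exists (s ++ t).
rewrite big_cat; split=> // c; rewrite mem_cat => /orP[]; [exact: sI|exact: tI].
Qed.

Lemma ideal_powM k a x : pw k x -> pw k (a * x).
Proof.
case: k => // k; move: x; apply: ideal_powS_ind => [|x y|x y px py].
- by rewrite mulr0; apply: ideal_pow_zero.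
- by rewrite mulrDr; apply: ideal_powD.
- by rewrite mulrA; apply: ideal_powM1 => //; apply: idealMr.
Qed.

Lemma ideal_powN k x : pw k x -> pw k (- x).
Proof. by rewrite -mulN1r; apply: ideal_powM. Qed.

Lemma ideal_powB k x y : pw k x -> pw k y -> pw k (x - y).
Proof. by move=> px /ideal_powN; apply: ideal_powD. Qed.

Lemma ideal_powSW k : pw k.+1 `<=` pw k.
Proof.
apply: ideal_powS_ind => [|x y|x y _ py].
- exact: ideal_pow_zero.
- exact: ideal_powD.
- exact: ideal_powM.
Qed.

Lemma ideal_powW i j : (i <= j)%N -> pw j `<=` pw i.
Proof.
move=> /subnK <-; elim: (j - i)%N => // k IHk x; rewrite addSn.
by move/ideal_powSW/IHk.
Qed.

Lemma ideal_pow1 x : pw 1 x <-> x \in p.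
Proof.
split; last by move=> px; rewrite -[x]mulr1; apply: ideal_powM1.
move: x; apply: ideal_powS_ind => [|x y|x y px _].
- exact: idealr0.
- exact: rpredD.
- by rewrite mulrC idealMr.
Qed.

Lemma ideal_powS_in k x : pw k.+1 x -> x \in p.
Proof. by move=> px; apply/ideal_pow1; apply: ideal_powW px. Qed.

Lemma ideal_powMD i j x y : pw i x -> pw j y -> pw (i + j) (x * y).
Proof.
elim: i x => [|i IHi] x px py; first exact: ideal_powM.
rewrite addSn; move: x px; apply: ideal_powS_ind => [|x z px pz|x z px pz].
- by rewrite mul0r; apply: ideal_pow_zero.
- by rewrite mulrDl; apply: ideal_powD.
- by rewrite -mulrA; apply: ideal_powM1 => //; apply: IHi.
Qed.

Lemma ideal_powX k x : x \in p -> pw k (x ^+ k).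
Proof. by move=> px; elim: k => // k IHk; rewrite exprS; apply: ideal_powM1. Qed.

Lemma prime_idealrX k x : x ^+ k \in p -> x \in p.
Proof.
elim: k => [|k IHk]; first by rewrite expr0 idealr1.
by rewrite exprS prime_idealrM => /orP[].
Qed.

Lemma prime_idealrXn k x : x \notin p -> x ^+ k \notin p.
Proof. by apply: contra; apply: prime_idealrX. Qed.

(** An ideal that is not contained in all the powers of [p] has an exponent. *)
Lemma ideal_exponent_exists (I : set R) :
  (exists M, ~ I `<=` pw M) -> exists k, ideal_exponent p I k.
Proof.
case=> M IM; pose P k := `[< ~ I `<=` pw k >].
have exP : exists k, P k by exists M; apply/asboolP.
case: (ex_minnP exP) => -[|k] /asboolP Ik k_min; first by case: Ik.
exists k; split=> //; apply: contrapT => Ik'.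
suff: (k.+1 <= k)%N by rewrite ltnn.
exact/k_min/asboolP.
Qed.

Lemma ideal_span_subP a k : ideal_span [set a] `<=` pw k <-> pw k a.
Proof.
split=> [|pa _ [s [sa ->]]].
  apply; exists [:: (1, a)]; rewrite big_seq1 mul1r; split=> // c.
  by rewrite inE => /eqP->.
elim: s sa => [_|c s IHs sa]; rewrite ?big_nil ?big_cons.
  exact: ideal_pow_zero.
apply: ideal_powD; last by apply: IHs => d sd; apply: sa; rewrite inE sd orbT.
by rewrite (sa c (mem_head _ _)); apply: ideal_powM.
Qed.

Lemma exact_exponent x :
  (exists M, ~ pw M x) -> exists k, pw k x /\ ~ pw k.+1 x.
Proof.
case=> M xM; have [|k [xk xk']] := @ideal_exponent_exists (ideal_span [set x]).
  by exists M => /ideal_span_subP.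
by exists k; split; [apply/ideal_span_subP|move=> /ideal_span_subP].
Qed.

Hypothesis p_max : forall s, s \notin p -> exists t, 1 - s * t \in p.

Lemma inv_mod_pow k s : s \notin p -> exists t, pw k (1 - s * t).
Proof.
move=> /p_max[t st]; elim: k => [|k [t' st']]; first by exists 0.
exists (t + t' - s * t * t').
have -> : 1 - s * (t + t' - s * t * t') = (1 - s * t) * (1 - s * t') by ring.
exact: ideal_powM1.
Qed.

(** Powers of a maximal ideal are primary. *)
Lemma ideal_pow_primary k s x : s \notin p -> pw k (s * x) -> pw k x.
Proof.
move=> /(@inv_mod_pow k)[t st] psx.
have -> : x = t * (s * x) + x * (1 - s * t) by ring.
by apply: ideal_powD; apply: ideal_powM.
Qed.

Lemma unit_modP k x : unit_mod (pw k.+1) x <-> x \notin p.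
Proof.
split=> [[y /ideal_powS_in pxy]|/(@inv_mod_pow k.+1)[t xt]].
  apply/negP => px; move: (idealr1 p).
  have -> : 1 = x * y - (x * y - 1) by ring.
  by rewrite rpredB // mulrC idealMr.
by exists t; rewrite -opprB; apply: ideal_powN.
Qed.

End IdealPow.

(** * The ring of integers modulo 2 *)

Section IntVal.
Variable K : fieldType.
Implicit Types x y : 'O_K.

Lemma int_valD x y : int_val (x + y) = int_val x + int_val y.
Proof. by []. Qed.
Lemma int_valN x : int_val (- x) = - int_val x.
Proof. by []. Qed.
Lemma int_valM x y : int_val (x * y) = int_val x * int_val y.
Proof. by []. Qed.
Lemma int_val0 : int_val (0 : 'O_K) = 0.
Proof. by []. Qed.
Lemma int_val1 : int_val (1 : 'O_K) = 1.
Proof. by []. Qed.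
Lemma int_val_inj : injective (@int_val K).
Proof. exact: val_inj. Qed.
Lemma int_valX x k : int_val (x ^+ k) = int_val x ^+ k.
Proof. by elim: k => // k IHk; rewrite !exprS int_valM IHk. Qed.
Lemma int_val_nat n : int_val (n%:R : 'O_K) = n%:R.
Proof. by elim: n => // n IHn; rewrite !mulrS int_valD IHn int_val1. Qed.
Lemma int_val_int (z : int) : int_val (z%:~R : 'O_K) = z%:~R.
Proof. by case: z => n; rewrite ?NegzE ?mulrNz ?int_valN -!pmulrn int_val_nat. Qed.
Lemma int_val_sum I (r : seq I) (P : pred I) (G : I -> 'O_K) :
  int_val (\sum_(i <- r | P i) G i) = \sum_(i <- r | P i) int_val (G i).
Proof. by apply: (big_morph (@int_val K)). Qed.

End IntVal.

Section FiniteMod2.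
Variable K : fieldExtType rat.
Implicit Types (s : seq 'O_K) (x y z w : 'O_K).

(** [x] is an integral combination of the elements of [s] modulo 2. *)
Definition spans_mod2 s x : Prop :=
  exists (c : nat -> int) w,
    x = \sum_(i < size s) (c i)%:~R * s`_i + 2 * w.

(** No element of [s] is an integral combination modulo 2 of the elements that
    follow it; this is linear independence over the field with two elements. *)
Fixpoint free_mod2 s : Prop :=
  if s is x :: s' then ~ spans_mod2 s' x /\ free_mod2 s' else True.

Lemma free_mod2_even s (c : nat -> int) w : free_mod2 s ->
  \sum_(i < size s) (c i)%:~R * s`_i = 2 * w ->
  forall i, (i < size s)%N -> (2 %| c i)%Z.
Proof.
elim: s c w => // x s IHs c w [xNs sfree] /=.
rewrite big_ord_recl /=; set S := \sum_(i < _) _ => sumE.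
have c0even : (2 %| c 0%N)%Z.
  apply/negPn/negP => c0odd; apply: xNs.
  have {c0odd} [m c0E] : exists m : int, c 0%N = 2 * m + 1.
    exists (divz (c 0%N) 2); have := divz_eq (c 0%N) 2.
    have := modz_ge0 (c 0%N) (isT : (2 : int) != 0).
    have := ltz_mod (c 0%N) (isT : (2 : int) != 0).
    by rewrite dvdzE in c0odd *; move: c0odd; lia.
  exists (fun i => - c i.+1), (w - m%:~R * x).
  have -> : \sum_(i < size s) (- c i.+1)%:~R * s`_i = - S.
    by rewrite -sumrN; apply: eq_bigr => i _; rewrite mulrNz mulNr.
  have {}sumE : S = 2 * w - (c 0%N)%:~R * x by rewrite -sumE; ring.
  by rewrite sumE c0E rmorphD rmorphM rmorph1 /=; ring.
have /dvdzP[m c0E] := c0even.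
have IH := IHs (fun i => c i.+1) (w - m%:~R * x) sfree.
case=> // i; rewrite ltnS; apply: IH.
have -> : \sum_(j < size s) (c j.+1)%:~R * s`_j = S by [].
have -> : S = 2 * w - (c 0%N)%:~R * x by rewrite -sumE; ring.
by rewrite c0E rmorphM /=; ring.
Qed.

(** A linear relation over the rationals can be scaled to a relation with
    coprime integer coefficients, which are not all even. *)
Lemma free_mod2_size s : free_mod2 s -> (size s <= \dim {:K})%N.
Proof.
move=> sfree; pose X := in_tuple (map (@int_val K) s).
have sizeX : size X = size s by rewrite size_map.
rewrite leqNgt; apply/negP => dim_lt.
have Xnfree : ~~ free X.
  apply/negP => Xfree; move: dim_lt; apply/negP; rewrite -leqNgt.
  rewrite -sizeX -(eqP (Xfree : \dim <<X>> == size X)).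
  exact/dimvS/subvf.
have [k [ksum [i0 ki0]]] : exists k : 'I_(size (map (@int_val K) s)) -> rat,
    \sum_i k i *: X`_i = 0 /\ exists i, k i <> 0.
  apply: contrapT => noK; case/negP: Xnfree; apply/freeP => k ksum i.
  by apply: contrapT => ki0; apply: noK; exists k; split=> //; exists i.
pose kk n := oapp k 0 (insub n).
have kkE i : kk (val i) = k i by rewrite /kk valK.
pose P : {poly rat} := \poly_(i < size (map (@int_val K) s)) kk i.
have [Q [a a0 PE]] := rat_poly_scale P.
have P0 : P != 0.
  apply/eqP => P0; apply: ki0; rewrite -kkE.
  by have := coef_poly (size (map (@int_val K) s)) kk i0; rewrite -/P P0 coef0 ltn_ord.
have Q0 : Q != 0 by apply: contraNneq P0 => Q0; rewrite PE Q0 rmorph0 scaler0.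
pose c i : int := (zprimitive Q)`_i.
have b0 : (zcontents Q)%:~R / a%:~R != 0 :> rat.
  by rewrite mulf_neq0 ?invr_eq0 ?intr_eq0 ?zcontents_eq0.
have kE i : k i = (zcontents Q)%:~R / a%:~R * (c i)%:~R.
  have := coef_poly (size (map (@int_val K) s)) kk i; rewrite -/P ltn_ord kkE => <-.
  by rewrite PE {1}[Q]zpolyEprim coefZ coef_map coefZ /= intrM mulrA [_^-1 * _]mulrC.
have csum : \sum_(i < size s) (c i)%:~R * s`_i = 2 * 0.
  apply: int_val_inj; rewrite int_val_sum mulr0 int_val0.
  have: ((zcontents Q)%:~R / a%:~R : rat) *:
      (\sum_(i < size (map (@int_val K) s)) (c i)%:~R * (map (@int_val K) s)`_i) = 0.
    rewrite -[RHS]ksum scaler_sumr; apply: eq_bigr => i _.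
    rewrite kE -[RHS]scalerA; congr (_ *: _); by rewrite scaler_int mulrzl.
  move/eqP; rewrite scaler_eq0 (negPf b0) /= => /eqP sum0.
  rewrite -[RHS]sum0 size_map; apply: eq_bigr => i _.
  by rewrite ?int_valM int_val_int (nth_map 0).
have := free_mod2_even sfree csum => even_c.
have : (2 %| zcontents (zprimitive Q))%Z.
  rewrite dvdz_contents; apply/polyOverP => i; rewrite -/(c i).
  have [/even_c//|i_ge] := ltnP i (size s).
  rewrite /c nth_default ?dvdz0 // size_zprimitive.
  apply: leq_trans i_ge; rewrite -(size_rat_int_poly Q).
  have -> : size (map_poly intr Q : {poly rat}) = size P.
    by rewrite PE size_scale // invr_eq0 intr_eq0.
  by apply: leq_trans (size_poly _ _) _; rewrite size_map.
by rewrite zcontents_primitive Q0.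
Qed.

Lemma finite_mod2 : exists r : seq 'O_K,
  forall x, exists2 y, y \in r & exists z, x = y + 2 * z.
Proof.
have [s s_spans] : exists s, forall x, spans_mod2 s x.
  apply: contrapT => no_s.
  have [s [sfree sizes]] : exists s, free_mod2 s /\ size s = (\dim {:K}).+1.
    elim: _.+1 => [|n [s [sfree sizes]]]; first by exists [::].
    have [x xNs] : exists x, ~ spans_mod2 s x.
      apply: contrapT => all_s; apply: no_s; exists s => x.
      by apply: contrapT => xNs; apply: all_s; exists x.
    by exists (x :: s); rewrite /= sizes.
  by have := free_mod2_size sfree; rewrite sizes ltnn.
pose S (f : {ffun 'I_(size s) -> bool}) : 'O_K :=
  \sum_(i < size s) (nat_of_bool (f i))%:R * s`_i.
exists (map S (enum {: {ffun 'I_(size s) -> bool}})).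
move=> x; have [c [w xE]] := s_spans x.
pose f : {ffun 'I_(size s) -> bool} := [ffun i => ~~ (2 %| c (val i))%Z].
exists (S f); first by apply/mapP; exists f; rewrite ?mem_enum.
exists (\sum_(i < size s) (divz (c i) 2)%:~R * s`_i + w).
rewrite xE /S mulrDr addrA; congr (_ + _).
rewrite mulr_sumr -big_split /=; apply: eq_bigr => i _.
have cE : c i = (nat_of_bool (f i))%:Z + 2 * divz (c i) 2.
  rewrite ffunE /=; have := divz_eq (c i) 2.
  have := modz_ge0 (c i) (isT : (2 : int) != 0).
  have := ltz_mod (c i) (isT : (2 : int) != 0).
  rewrite dvdzE; lia.
by rewrite {1}cE rmorphD rmorphM /= mulrDl mulrA.
Qed.

End FiniteMod2.

(** * The localisation at a prime above 2 *)

Section Integrality.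
Variable K : fieldType.

Lemma integral_root (p : {poly 'O_K}) n (x : K) : (size p <= n)%N ->
  x ^+ n + (map_poly (@int_val K) p).[x] = 0 -> exists z : 'O_K, int_val z = x.
Proof.
move=> size_p px0; pose P := 'X^n + map_poly (@int_val K) p.
have size_mp : (size (map_poly (@int_val K) p) < size ('X^n : {poly K}))%N.
  by rewrite size_polyXn ltnS (leq_trans (size_poly _ _)).
have x_int : x \in @integral_elt K.
  apply/asboolP; apply: (@integral_root_monic _ _ intr x P).
  - by rewrite monicE lead_coefDl ?lead_coefXn.
  - by rewrite rootE hornerD hornerXn px0.
  apply/integral_poly => i; rewrite coefD coefXn; apply: integral_add.
    by case: (i == n); [exact: integral1|exact: integral0].
  rewrite coef_map_id0 //; exact/asboolP/int_valP.
by exists (RingOfIntegers x_int).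
Qed.

Lemma integral_quadratic (b c : 'O_K) (x : K) :
  x ^+ 2 + int_val b * x + int_val c = 0 -> exists z : 'O_K, int_val z = x.
Proof.
move=> x0; apply: (@integral_root (b%:P * 'X + c%:P) 2 x).
  rewrite (leq_trans (size_polyD _ _)) // geq_max.
  rewrite (leq_trans (size_polyC_leq1 _)) // andbT.
  rewrite mul_polyC (leq_trans (size_scale_leq _ _)) // size_polyX //.
have -> : map_poly (@int_val K) (b%:P * 'X + c%:P) = (int_val b)%:P * 'X + (int_val c)%:P.
  apply/polyP => i; rewrite coef_map_id0 // !(coefD, coefC, coefCM, coefX).
  by case: i => [|[|i]] /=; rewrite ?int_valD ?int_valM.
by rewrite !hornerE; exact: x0.
Qed.

(** A nonzero integer of [K] divides a nonzero rational integer, the constant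
    term of a polynomial that it is a root of. *)
Lemma int_multiple (x : 'O_K) : x != 0 ->
  exists (y : 'O_K) (n : int), n != 0 /\ x * y = n%:~R.
Proof.
move=> x0; have /asboolP[p p_mon] := int_valP x.
rewrite /root; move/eqP; elim/poly_ind: p p_mon => [/monic_neq0/eqP//|p n IHp] p_mon.
have pE : map_poly (intr : int -> K) (p * 'X + n%:P) =
          map_poly intr p * 'X + (n%:~R)%:P.
  by rewrite rmorphD rmorphM /= map_polyX map_polyC.
rewrite pE hornerD hornerC hornerMX.
have [p0|p0] := eqVneq p 0.
  rewrite p0 mul0r add0r in p_mon *.
  have -> : n = 1 by move: p_mon; rewrite monicE lead_coefC => /eqP.
  rewrite rmorph0 horner0 mul0r add0r => /eqP; by rewrite oner_eq0.
have {}p_mon : p \is monic.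
  move: p_mon; rewrite !monicE lead_coefDl ?lead_coefMX //.
  by rewrite size_mulX // size_polyC; case: (n != 0); rewrite ?ltnS ?size_poly_gt0.
have [y yE] : exists y : 'O_K, int_val y = (map_poly intr p).[int_val x].
  elim/poly_ind: {IHp p0 p_mon pE} p => [|p c [y yE]].
    by exists 0; rewrite rmorph0 horner0.
  exists (y * x + c%:~R); rewrite int_valD int_valM yE int_val_int.
  by rewrite rmorphD rmorphM /= map_polyX map_polyC hornerD hornerMX hornerC.
rewrite -yE => yx; have [n0|n0] := eqVneq n 0.
  apply: IHp => //; rewrite -yE; move/eqP: yx; rewrite n0 addr0 mulf_eq0.
  case/orP => [/eqP//|/eqP x0']; case/eqP: x0; exact: int_val_inj.
exists (- y), n; split=> //; apply: int_val_inj; rewrite int_valM int_valN int_val_int.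
by apply/eqP; rewrite -subr_eq0 -oppr_eq0 -[X in _ == X]yx; apply/eqP; ring.
Qed.

End Integrality.

Section Local.
Variable K : fieldType.
Hypothesis K_fin : exists r : seq 'O_K,
  forall x, exists2 y, y \in r & exists z, x = y + 2 * z.
Hypothesis K2_neq0 : 2 != 0 :> K.

Lemma pigeonhole_mod2 (f : nat -> 'O_K) :
  exists i j, (i < j)%N /\ exists z, f i - f j = 2 * z.
Proof.
have [r r_rep] := K_fin.
have /choice[g gP] : forall n, exists y, y \in r /\ exists z, f n = y + 2 * z.
  by move=> n; have [y yr yE] := r_rep (f n); exists y.
pose s := map g (iota 0 (size r).+1).
have /(uniqPn 0)[i [j [ij js]]] : ~~ uniq s.
  apply/negP => /uniq_leq_size sr.
  have /sr : {subset s <= r} by move=> _ /mapP[n _ ->]; have [] := gP n.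
  by rewrite size_map size_iota ltnn.
rewrite size_map size_iota in js; have is_ := ltn_trans ij js.
rewrite !(nth_map 0%N) ?size_iota // !nth_iota // !add0n => gij.
exists i, j; split=> //.
have [_ [z ->]] := gP i; have [_ [w ->]] := gP j.
by exists (z - w); rewrite gij; ring.
Qed.

(** Only finitely many classes modulo 2 are available for the multiples
    [2 * t ^+ k], so [t] is a root of some [X ^+ j - X ^+ i - z]. *)
Lemma complete_integral_closure (t : K) :
  (forall k, exists z : 'O_K, int_val z = 2 * t ^+ k) ->
  exists z : 'O_K, int_val z = t.
Proof.
move=> /choice[f fE]; have [i [j [ij [z fij]]]] := pigeonhole_mod2 f.
apply: (@integral_root _ (z%:P - 'X^i) j t).
  rewrite (leq_trans (size_polyD _ _)) // geq_max size_polyN size_polyXn ij.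
  by rewrite (leq_trans (size_polyC_leq1 _)) // (leq_ltn_trans _ ij).
have -> : map_poly (@int_val K) (z%:P - 'X^i) = (int_val z)%:P - 'X^i.
  apply/polyP => m; rewrite coef_map_id0 // !(coefB, coefC, coefXn).
  by rewrite int_valD int_valN int_val_nat; case: m.
rewrite hornerD hornerN hornerC hornerXn; apply: (mulfI K2_neq0); rewrite mulr0.
have /(congr1 (@int_val K)) := fij.
rewrite int_valD int_valN int_valM !fE int_val_nat => zE.
by rewrite mulrDr mulrBr -zE; ring.
Qed.

Section Prime.
Variable q : prime_idealr 'O_K.
Hypothesis q2 : 2 \in q.
Implicit Types (x y z s b : 'O_K).
Local Notation pw := (ideal_pow [set` q]).

Lemma even_in x : 2 * x \in q.
Proof. by rewrite mulrC idealMr. Qed.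

Lemma prime_above2_max s : s \notin q -> exists t, 1 - s * t \in q.
Proof.
move=> sq; have [i [j [ij [z sE]]]] := pigeonhole_mod2 (fun n => s ^+ n).
exists (s ^+ (j - i).-1).
rewrite -exprS prednK ?subn_gt0 //.
have : s ^+ i * (1 - s ^+ (j - i)) \in q.
  by rewrite mulrBr mulr1 -exprD subnKC ?(ltnW ij) // sE even_in.
by rewrite prime_idealrM (negPf (prime_idealrXn _ sq)).
Qed.

(** Squaring is injective modulo [q], hence, the residue field being finite,
    every element is a square modulo [q]. *)
Lemma square_mod x : exists y, x - y ^+ 2 \in q.
Proof.
have [i [j [ij [z xE]]]] := pigeonhole_mod2 (fun n => x ^+ (2 ^ n)).
exists (x ^+ (2 ^ (j - i).-1)).
rewrite -exprM -expnSr prednK ?subn_gt0 //.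
have sqr_inj a b : a ^+ 2 - b ^+ 2 \in q -> a - b \in q.
  move=> ab; apply: (@prime_idealrX _ q 2).
  have -> : (a - b) ^+ 2 = a ^+ 2 - b ^+ 2 - 2 * (b * (a - b)) by ring.
  by rewrite rpredB // even_in.
have : x ^+ (2 ^ i) - (x ^+ (2 ^ (j - i))) ^+ (2 ^ i) \in q.
  by rewrite -(exprM x (2 ^ (j - i))%N) -expnD subnK ?(ltnW ij) // xE even_in.
move: (x ^+ (2 ^ (j - i))); elim: i {ij z xE} => [|i IHi] y; first by rewrite !expr1.
by rewrite expnSr !exprM => /sqr_inj/IHi.
Qed.

(** [b] does not vanish in the localisation at [q] of the integers mod 2. *)
Definition local_nonzero b := forall s z, s \notin q -> s * b <> 2 * z.

(** With [j] minimal such that [y ^+ j * b] vanishes locally modulo 2, the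
    multiplier [a] is [y ^+ j.-1]. *)
Lemma annihilate1 y b : y \in q -> local_nonzero b ->
  exists a, local_nonzero (a * b) /\
    exists2 s, s \notin q & exists z, s * (a * b) * y = 2 * z.
Proof.
move=> yq b0.
pose P j :=
  `[< exists2 s, s \notin q & exists z, s * (y ^+ j * b) = 2 * z >].
have exP : exists j, P j.
  have [i [j [ij [z yE]]]] := pigeonhole_mod2 (fun n => y ^+ n).
  exists i; apply/asboolP; exists (1 - y ^+ (j - i)).
    apply/negP => yji; move: (idealr1 q).
    have -> : 1 = (1 - y ^+ (j - i)) + y ^+ (j - i) by ring.
    rewrite rpredD // -(prednK (_ : 0 < j - i)%N) ?subn_gt0 //.
    by rewrite exprSr idealMr.
  exists (z * b); have -> : (1 - y ^+ (j - i)) * (y ^+ i * b) =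
      (y ^+ i - y ^+ i * y ^+ (j - i)) * b by ring.
  by rewrite -exprD subnKC ?(ltnW ij) // yE mulrA.
case: (ex_minnP exP) => -[|j] /asboolP[s sq [z sE]] j_min.
  by case: (b0 s z sq); rewrite -sE expr0 mul1r.
exists (y ^+ j); split; last first.
  by exists s => //; exists z; rewrite -sE exprS; ring.
move=> s' z' s'q s'E; suff: (j.+1 <= j)%N by rewrite ltnn.
by apply: j_min; apply/asboolP; exists s' => //; exists z'.
Qed.

(** An element of the socle: the representatives modulo 2 of the elements of
    [q] are annihilated one after the other. *)
Lemma annihilate : exists b, local_nonzero b /\
  forall y, y \in q -> exists z, b * y = 2 * z.
Proof.
have [r r_rep] := K_fin.
have [b [b0 [s sq sP]]] : exists b, local_nonzero b /\ exists2 s, s \notin q &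
    forall y, y \in r -> y \in q -> exists z, s * b * y = 2 * z.
  elim: {r_rep} r => [|y r [b [b0 [s sq sP]]]].
    exists 1; split; last by exists 1; rewrite ?idealr1.
    by move=> s z sq sE; move: sq; rewrite -[s]mulr1 sE even_in.
  have [yq|yNq] := boolP (y \in q); last first.
    exists b; split=> //; exists s => // y'; rewrite inE => /orP[/eqP->|/sP//].
    by rewrite (negPf yNq).
  have [a [ab0 [s' s'q [z zE]]]] := annihilate1 yq b0.
  exists (a * b); split=> //; exists (s * s').
    by rewrite prime_idealrM negb_or sq.
  move=> y'; rewrite inE => /orP[/eqP-> _|/sP y'P /y'P[z' z'E]].
    by exists (s * z); rewrite [RHS]mulrCA -zE; ring.
  by exists (s' * a * z'); rewrite [RHS]mulrCA -z'E; ring.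
exists (s * b); split.
  by move=> s' z s'q; rewrite mulrA; apply: b0; rewrite prime_idealrM negb_or s'q.
move=> x xq; have [y yr [z xE]] := r_rep x.
have yq : y \in q.
  have -> : y = x - 2 * z by rewrite xE; ring.
  by rewrite rpredB ?even_in.
have [w wE] := sP y yr yq.
by exists (w + s * b * z); rewrite xE mulrDr wE; ring.
Qed.

(** [tau] is an inverse of a uniformiser [pi] at [q], up to the local unit [u],
    and multiplication by [tau] sends [q] into the ring of integers. *)
Definition uniformizing (tau : K) (pi u : 'O_K) : Prop :=
  [/\ pi \in q, u \notin q, tau * int_val pi = int_val u
    & forall x, x \in q -> exists y, int_val y = tau * int_val x].

Lemma uniformizing_exists : exists tau pi u, uniformizing tau pi u.
Proof.
have [b [b0 bq]] := annihilate; pose tau : K := int_val b / 2.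
have tau_int x : x \in q -> exists y, int_val y = tau * int_val x.
  move=> /bq[z zE]; exists z; apply: (mulfI K2_neq0).
  have /(congr1 (@int_val K)) := zE; rewrite !int_valM int_val_nat => <-.
  by rewrite /tau mulrA mulrCA divff // mulr1.
apply: contrapT => no_unif.
have tau_q x : x \in q -> exists2 y, y \in q & int_val y = tau * int_val x.
  move=> xq; have [y yE] := tau_int x xq; exists y => //; apply: contrapT => /negP yq.
  by apply: no_unif; exists tau, x, y.
have [|z zE] := @complete_integral_closure tau.
  move=> k; suff [z zq zE] : exists2 z, z \in q & int_val z = 2 * tau ^+ k.
    by exists z.
  elim: k => [|k [z zq zE]]; first by exists 2; rewrite ?mulr1 ?int_val_nat.
  by have [y yq yE] := tau_q z zq; exists y; rewrite // yE zE exprS mulrCA.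
case: (b0 1 z); rewrite ?idealr1 // mul1r; apply: int_val_inj.
by rewrite int_valM int_val_nat zE /tau mulrCA divff // mulr1.
Qed.

Section Uniformizer.
Variables (tau : K) (pi u : 'O_K).
Hypothesis unif : uniformizing tau pi u.

Lemma uniformizing_in x y : int_val y = tau * int_val x -> x \in q.
Proof.
have [piq uq tau_pi _] := unif => yE.
have : u * x \in q.
  suff -> : u * x = y * pi by rewrite idealMr.
  by apply: int_val_inj; rewrite !int_valM -tau_pi yE; ring.
by rewrite prime_idealrM (negPf uq).
Qed.

(** The powers of [q] are the valuation ideals. *)
Lemma ideal_powP k x : pw k x <-> exists y, int_val y = tau ^+ k * int_val x.
Proof.
have [piq uq tau_pi tau_int] := unif; split.
  elim: k x => [|k IHk] x; first by exists x; rewrite mul1r.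
  move: x; apply: ideal_powS_ind => [|x y [x' x'E] [y' y'E]|a x aq /IHk[x' x'E]].
  - by exists 0; rewrite int_val0 mulr0.
  - by exists (x' + y'); rewrite !int_valD x'E y'E mulrDr.
  - have [a' a'E] := tau_int a aq.
    by exists (a' * x'); rewrite !int_valM a'E x'E exprS; ring.
move=> [y yE]; apply: (@ideal_pow_primary _ q prime_above2_max k (u ^+ k)).
  exact: prime_idealrXn.
have -> : u ^+ k * x = y * pi ^+ k.
  apply: int_val_inj; rewrite !int_valM !int_valX -tau_pi yE exprMn; ring.
by apply: ideal_powM; apply: ideal_powX.
Qed.

Lemma ideal_powSP k x y : int_val y = tau ^+ k * int_val x ->
  pw k.+1 x <-> y \in q.
Proof.
have [piq uq tau_pi tau_int] := unif => yE; split.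
  move=> /ideal_powP[z zE]; apply: (@uniformizing_in y z).
  by rewrite zE yE exprS; ring.
move=> /tau_int[z zE]; apply/ideal_powP; exists z.
by rewrite zE yE exprS; ring.
Qed.

Lemma ideal_pow_notM i j x y : pw i x -> ~ pw i.+1 x -> pw j y -> ~ pw j.+1 y ->
  ~ pw (i + j).+1 (x * y).
Proof.
move=> /ideal_powP[x' x'E] xi /ideal_powP[y' y'E] yj xyij.
have xyE : int_val (x' * y') = tau ^+ (i + j) * int_val (x * y).
  by rewrite !int_valM x'E y'E exprD; ring.
move/(ideal_powSP xyE): xyij.
by rewrite prime_idealrM => /orP[/(ideal_powSP x'E)|/(ideal_powSP y'E)].
Qed.

End Uniformizer.

Lemma two_notin_ideal_pow : exists M, ~ pw M 2.
Proof.
have [tau [pi [u unif]]] := uniformizing_exists.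
apply: contrapT => no_M.
have [|z zE] := @complete_integral_closure tau.
  move=> k; have /(ideal_powP unif)[y yE] : pw k 2.
    by apply: contrapT => ?; apply: no_M; exists k.
  by exists y; rewrite yE int_val_nat mulrC.
have : 1 \in q by apply: (uniformizing_in unif (y := z)); rewrite int_val1 mulr1.
by rewrite idealr1.
Qed.

Lemma nat_exponent n : (0 < n)%N -> exists k, pw k n%:R /\ ~ pw k.+1 n%:R.
Proof.
have [tau [pi [u unif]]] := uniformizing_exists.
have [e [e2 e2']] := exact_exponent two_notin_ideal_pow.
elim/ltn_ind: n => n IHn n0.
have [n_odd|n_even] := boolP (odd n).
  exists 0%N; split=> // /ideal_pow1 nq; move: (idealr1 q).
  have -> : 1 = n%:R - 2 * (n./2)%:R :> 'O_K.
    have nE : n = (1 + n./2 * 2)%N by rewrite muln2 -{1}[n]odd_double_half n_odd.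
    by rewrite {1}nE natrD natrM; ring.
  by rewrite rpredB // even_in.
have nE : n = (2 * n./2)%N by rewrite -{1}[n]odd_double_half (negPf n_even) -muln2 mulnC.
have [||k [kn kn']] := IHn n./2; [lia|lia|].
exists (e + k)%N; rewrite nE natrM; split; first exact: ideal_powMD.
exact: (ideal_pow_notM unif).
Qed.

Lemma nonzero_exponent x : x != 0 -> exists k, pw k x /\ ~ pw k.+1 x.
Proof.
move=> /int_multiple[y [n [n0 xy]]].
have [|k [_ nk]] := @nat_exponent `|n|%N; first by rewrite absz_gt0.
apply: exact_exponent; exists k.+1 => xk; apply: nk.
have -> : (`|n|%N)%:R = (-1) ^+ (n < 0)%R * y * x.
  rewrite -mulrA [y * x]mulrC xy; case: n {n0 xy} => m /=.
    by rewrite expr0 mul1r.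
  by rewrite NegzE mulrNz expr1 mulN1r opprK.
exact: ideal_powM.
Qed.

End Prime.
End Local.

(** * Primes above a prime in an extension *)

(** The subset [A] is turned into a boolean predicate by classical logic. *)
Lemma prime_idealr_of_set (R : comNzRingType) (A : set R) :
    A 0 -> ~ A 1 -> (forall x y, A x -> A y -> A (x + y)) ->
    (forall a x, A x -> A (a * x)) ->
    (forall x y, A (x * y) -> A x \/ A y) ->
  exists P : prime_idealr R, forall x, (x \in P) = `[< A x >].
Proof.
move=> A0 A1 AD AM Apr; pose B : R -> bool := fun x => `[< A x >].
have BI : idealr_closed B.
  split=> [||a x y /asboolP Ax /asboolP Ay].
  - exact/asboolP.
  - by apply/asboolP.
  - by apply/asboolP/AD => //; apply: AM.
have BP : prime_idealr_closed B.
  by move=> x y /asboolP/Apr[] Axy; apply/orP; [left|right]; apply/asboolP.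
pose B_ideal := isIdealr.Build R B BI.
pose B_prime := isPrimeIdealrClosed.Build R B BP.
pose P : prime_idealr R := HB.pack B B_ideal B_prime.
by exists P.
Qed.

Section Extension.
Variables (F : fieldExtType rat) (L : fieldExtType F).
Implicit Types (x y a b c : 'O_F) (z w : 'O_L).

Lemma finite_mod2_ext : exists r : seq 'O_L,
  forall z, exists2 w, w \in r & exists w', z = w + 2 * w'.
Proof. exact: (@finite_mod2 (baseFieldType L)). Qed.

Lemma two_neq0 : 2 != 0 :> F.
Proof. by rewrite -(rmorph_nat (in_alg F)) fmorph_eq0. Qed.

Lemma two_neq0_ext : 2 != 0 :> L.
Proof. by rewrite -(rmorph_nat (in_alg L)) fmorph_eq0 two_neq0. Qed.

(** The structure map of [L] over [F]. *)
Definition emb (a : F) : L := in_alg L a.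

Lemma embD : {morph emb : a b / a + b}. Proof. exact: rmorphD. Qed.
Lemma embN : {morph emb : a / - a >-> - a}. Proof. exact: rmorphN. Qed.
Lemma embM : {morph emb : a b / a * b}. Proof. exact: rmorphM. Qed.
Lemma embX n : {morph emb : a / a ^+ n >-> a ^+ n}. Proof. exact: rmorphXn. Qed.
Lemma emb_nat n : emb n%:R = n%:R. Proof. exact: rmorph_nat. Qed.
Lemma emb0 : emb 0 = 0. Proof. exact: rmorph0. Qed.
Lemma emb1 : emb 1 = 1. Proof. exact: rmorph1. Qed.
Lemma emb_eq0 (a : F) : (emb a == 0) = (a == 0). Proof. exact: fmorph_eq0. Qed.

Local Notation ext := (int_ext L).

Lemma int_val_ext x : int_val (ext x) = emb (int_val x).
Proof. by []. Qed.

Lemma int_extD x y : ext (x + y) = ext x + ext y.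
Proof. by apply: int_val_inj; rewrite int_valD !int_val_ext int_valD embD. Qed.

Lemma int_extN x : ext (- x) = - ext x.
Proof. by apply: int_val_inj; rewrite int_valN !int_val_ext int_valN embN. Qed.

Lemma int_extM x y : ext (x * y) = ext x * ext y.
Proof. by apply: int_val_inj; rewrite int_valM !int_val_ext int_valM embM. Qed.

Lemma int_ext_nat n : ext n%:R = n%:R.
Proof. by apply: int_val_inj; rewrite int_val_ext !int_val_nat emb_nat. Qed.

(** The ring of integers of [F] is integrally closed in [F]. *)
Lemma int_descend z (a : F) : int_val z = emb a ->
  exists x, int_val x = a /\ ext x = z.
Proof.
move=> zE; have a_int : a \in @integral_elt F.
  have /asboolP[p p_mon pz0] := int_valP z.
  apply/asboolP; exists p => //.
  have pE : map_poly (intr : int -> L) p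
        = map_poly (in_alg L) (map_poly (intr : int -> F) p).
    rewrite -map_poly_comp; apply: eq_map_poly => n.
    by rewrite /= scaler_int.
  by move: pz0; rewrite /root pE zE horner_map fmorph_eq0.
by exists (RingOfIntegers a_int); split=> //; apply: int_val_inj; rewrite zE.
Qed.

Variable q : prime_idealr 'O_F.
Hypothesis q2 : 2 \in q.

Lemma ext_ideal_in x : x \in q -> ext_ideal q (ext x).
Proof.
move=> xq; exists [:: (1, ext x)]; rewrite big_seq1 mul1r; split=> // c.
by rewrite inE => /eqP-> /=; exists x.
Qed.

Lemma ext_ideal_ind (X : set 'O_L) : X 0 ->
    (forall z w, X z -> X w -> X (z + w)) ->
    (forall z x, x \in q -> X (z * ext x)) ->
  ext_ideal q `<=` X.
Proof.
move=> X0 XD XM _ [s [sq ->]]; elim: s sq => [|c s IHs] sq.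
  by rewrite big_nil.
rewrite big_cons; apply: XD.
  by have [x xq <-] := sq c (mem_head _ _); apply: XM.
by apply: IHs => d sd; apply: sq; rewrite inE sd orbT.
Qed.

Lemma ext_ideal0 : ext_ideal q (0 : 'O_L).
Proof. by exists [::]; rewrite big_nil. Qed.

Lemma ext_idealD z w : ext_ideal q z -> ext_ideal q w -> ext_ideal q (z + w).
Proof.
move=> [s [sI ->]] [t [tI ->]]; exists (s ++ t).
rewrite big_cat; split=> // c; rewrite mem_cat => /orP[]; [exact: sI|exact: tI].
Qed.

Lemma ext_idealM w z : ext_ideal q z -> ext_ideal q (w * z).
Proof.
move: z; apply: ext_ideal_ind => [|z z'|z x xq].
- by rewrite mulr0; apply: ext_ideal0.
- by rewrite mulrDr; apply: ext_idealD.
- rewrite mulrA; exists [:: (w * z, ext x)]; rewrite big_seq1; split=> // c.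
  by rewrite inE => /eqP-> /=; exists x.
Qed.

Lemma ext_ideal_contract x : ext_ideal q (ext x) -> x \in q.
Proof.
have [tau [pi [u unif]]] :=
  uniformizing_exists (finite_mod2 F) two_neq0 q2.
have [piq uq tau_pi tau_int] := unif.
have tau_ext z : ext_ideal q z ->
    exists w, int_val w = emb tau * int_val z.
  move: z; apply: ext_ideal_ind => [|z z' [w wE] [w' w'E]|z y yq].
  - by exists 0; rewrite int_val0 mulr0.
  - by exists (w + w'); rewrite !int_valD wE w'E mulrDr.
  - have [y' y'E] := tau_int y yq; exists (z * ext y').
    by rewrite !int_valM !int_val_ext y'E embM mulrCA.
move=> /tau_ext[w]; rewrite int_val_ext -embM => /int_descend[y [yE _]].
exact: (uniformizing_in unif yE).
Qed.

(** A prime above [q] is an ideal containing the extension of [q] that is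
    maximal among those that meet the ring of integers of [F] inside [q].  The
    empty set satisfies the conditions imposed below, as an empty chain
    requires. *)
Lemma lying_over : exists P : prime_idealr 'O_L, lies_over P q.
Proof.
pose good (A : set 'O_L) := [/\ forall z w, A z -> A w -> A (z + w),
  forall w z, A z -> A (w * z),
  forall z w, A z -> ext_ideal q w -> A (z + w) &
  forall x, A (ext x) -> x \in q].
have [|A [[AD AM AJ Aq] Amax]] := @Zorn_bigcup _ good.
  move=> C Cgood Ctot.
  split=> [z w [A CA Az] [B CB Bw]|w z [A CA Az]|z w [A CA Az] Jw|x [A CA Ax]].
  - have [AB|BA] := Ctot A B CA CB.
      by exists B => //; have [BD _ _ _] := Cgood B CB; apply: BD => //; apply: AB.
    by exists A => //; have [AD _ _ _] := Cgood A CA; apply: AD => //; apply: BA.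
  - by exists A => //; have [_ AM _ _] := Cgood A CA; apply: AM.
  - by exists A => //; have [_ _ AJ _] := Cgood A CA; apply: AJ.
  - by have [_ _ _ Aq] := Cgood A CA; apply: Aq.
have [z0 Az0] : exists z, A z.
  apply: contrapT => A_empty; apply: (Amax (ext_ideal q)).
    split=> [z Az|JA]; first by case: A_empty; exists z.
    by apply: A_empty; exists 0; apply: JA; apply: ext_ideal0.
  split; [exact: ext_idealD|exact: ext_idealM|exact: ext_idealD|].
  exact: ext_ideal_contract.
have A0 : A 0 by rewrite -(mul0r z0); apply: AM.
have JA z : ext_ideal q z -> A z by move=> Jz; rewrite -[z]add0r; apply: AJ.
have A1 : ~ A 1.
  by move=> A1; have := idealr1 q; rewrite Aq // (int_ext_nat 1).
have meets z : ~ A z -> exists c w w', [/\ c \notin q, A w & ext c = w + w' * z].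
  move=> Az; apply: contrapT => no_c.
  pose B : set 'O_L := [set v | exists w w', A w /\ v = w + w' * z].
  apply: (Amax B).
    split=> [v Av|BA]; first by exists v, 0; rewrite mul0r addr0.
    by apply/Az/BA; exists 0, 1; rewrite add0r mul1r.
  split.
  - move=> _ _ [w [w' [Aw ->]]] [v [v' [Av ->]]]; exists (w + v), (w' + v').
    by split; [exact: AD|ring].
  - move=> v _ [w [w' [Aw ->]]]; exists (v * w), (v * w').
    by split; [exact: AM|ring].
  - move=> _ v [w [w' [Aw ->]]] Jv; exists (w + v), w'.
    by split; [exact: AJ|ring].
  - move=> c [w [w' [Aw cE]]]; apply: contrapT => /negP cq.
    by apply: no_c; exists c, w, w'.
have [|P PE] := prime_idealr_of_set A0 A1 AD AM.
  move=> z w Azw; apply: contrapT => /not_orP[/meets[c [v [v' [cq Av cE]]]]].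
  move=> /meets[d [y [y' [dq Ay dE]]]].
  have /Aq : A (ext (c * d)).
    rewrite int_extM cE dE.
    have -> : (v + v' * z) * (y + y' * w) =
      (y + y' * w) * v + (v' * z * y + (v' * y') * (z * w)) by ring.
    by apply: (AD); [exact: AM|apply: (AD); exact: AM].
  by rewrite prime_idealrM (negPf cq) (negPf dq).
exists P => x; rewrite PE; apply/asboolP/idP => [|xq]; first exact: Aq.
exact/JA/ext_ideal_in.
Qed.

Section Above.
Variable P : prime_idealr 'O_L.
Hypothesis Pq : lies_over P q.

Lemma two_in_above : 2 \in P.
Proof. by rewrite -(int_ext_nat 2) Pq. Qed.

Lemma above_max z : z \notin P -> exists w, 1 - z * w \in P.
Proof. exact: (prime_above2_max finite_mod2_ext two_in_above). Qed.

Lemma two_notin_above : exists M, ~ ideal_pow [set` P] M 2.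
Proof. exact: (two_notin_ideal_pow finite_mod2_ext two_neq0_ext two_in_above). Qed.

Lemma ramifies_in_above2 :
  (forall x, x \in q -> ideal_pow [set` P] 2 (ext x)) -> ramifies_in L q.
Proof.
move=> qP2; have IP2 : @ext_ideal _ L q `<=` ideal_pow [set` P] 2.
  apply: ext_ideal_ind => [|z w|z x xq].
  - exact: ideal_pow_zero.
  - exact: ideal_powD.
  - by apply: ideal_powM; apply: qP2.
have [|e [Ie Ie']] := @ideal_exponent_exists _ P (@ext_ideal _ L q).
  have [M M2] := two_notin_above; exists M => IM; apply: M2; apply: IM.
  by rewrite -(int_ext_nat 2); apply: ext_ideal_in.
exists P, e; split=> //; rewrite ltnNge; apply/negP => e1.
by apply: Ie'; apply: subset_trans IP2 _; apply: ideal_powW.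
Qed.

End Above.
End Extension.

Arguments emb [F] L a.

(** * Ramification in quadratic extensions *)

Section Quadratic.
Variables (F : fieldExtType rat) (q : prime_idealr 'O_F).
Hypothesis q2 : 2 \in q.
Implicit Types (x y a b c d t : 'O_F).
Local Notation pw := (ideal_pow [set` q]).

Let F2 : 2 != 0 :> F := two_neq0 F.
Let q_max := prime_above2_max (finite_mod2 F) q2.

(** The least [k] such that [d] is not a square modulo [q ^+ k] is even when it
    is at most [2 * e]: an approximate square root [x] of [d] modulo
    [q ^+ (2 * j)] with [j < e] can be improved to [x + pi ^+ j * y], as squares
    exhaust the residue field and the cross term is divisible by
    [2 * pi ^+ j]. *)
Lemma nonsquare_exponent d e : pw e 2 ->
  (forall x, ~ pw (2 * e) (d - x ^+ 2)) ->
  exists j x, [/\ (j < e)%N, pw j.*2.+1 (d - x ^+ 2)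
                 & ~ pw j.*2.+2 (d - x ^+ 2)].
Proof.
have [tau [pi [u unif]]] := uniformizing_exists (finite_mod2 F) F2 q2.
have pwP := ideal_powP (finite_mod2 F) q2 unif.
have pwSP := ideal_powSP (finite_mod2 F) q2 unif.
have [piq uq tau_pi tau_int] := unif.
move=> e2 d_nsq; pose N k := `[< forall x, ~ pw k (d - x ^+ 2) >].
have exN : exists k, N k by exists (2 * e)%N; apply/asboolP.
case: (ex_minnP exN) => -[|k] /asboolP Nk k_min; first by case: (Nk 0).
have k_lt : (k < 2 * e)%N by apply/k_min/asboolP.
have [x xk] : exists x, pw k (d - x ^+ 2).
  apply: contrapT => no_x; suff: (k.+1 <= k)%N by rewrite ltnn.
  by apply/k_min/asboolP => x xk; apply: no_x; exists x.
have [k_odd|k_even] := boolP (odd k).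
  have kE : k = k./2.*2.+1 by rewrite -{1}[k]odd_double_half k_odd.
  exists k./2, x; rewrite -kE; split=> //; lia.
have kE : k = k./2.*2 by rewrite -{1}[k]odd_double_half (negPf k_even).
move: (k./2) => j in kE; subst k.
have j_lt : (j < e)%N by lia.
have /pwP[w wE] := xk.
have /pwP[g gE] : pw j 2 by apply: ideal_powW e2; apply: ltnW.
have gq : g \in q by apply/(pwSP _ _ _ gE); apply: ideal_powW e2.
have [s sw] := square_mod (finite_mod2 F) q2 w.
have [t ut] := q_max (prime_idealrXn j uq).
pose y := s * t; case: (Nk (x + pi ^+ j * y)).
pose z := w - (u ^+ j * y) ^+ 2 - g * (x * y * u ^+ j).
apply/(pwSP _ _ z).
  have uE : int_val u ^+ j = tau ^+ j * int_val pi ^+ j by rewrite -tau_pi exprMn.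
  rewrite /z !(int_valD, int_valN, int_valM, int_valX) wE gE int_val_nat.
  rewrite !(int_valD, int_valN, int_valM, int_valX) uE -addnn exprD.
  by ring.
have -> : z = (w - s ^+ 2) +
    (1 - u ^+ j * t) * (s ^+ 2 * (1 + u ^+ j * t)) - g * (x * y * u ^+ j).
  by rewrite /z /y; ring.
apply: rpredB; first apply: rpredD => //; rewrite mulrC idealMr //.
Qed.

(** With [beta := tau ^+ j * (sqrt d - x)], which satisfies an Eisenstein
    equation [beta ^+ 2 + t * beta = c], the prime ideals above [q] contain
    [beta], hence their squares contain [c], which generates [q] locally. *)
Lemma nonsquare_ramifies d e : pw e 2 ->
  (forall x, ~ pw (2 * e) (d - x ^+ 2)) -> ramifies_in_sqrt q (int_val d).
Proof.
have [tau [pi [u unif]]] := uniformizing_exists (finite_mod2 F) F2 q2.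
have pwP := ideal_powP (finite_mod2 F) q2 unif.
have pwSP := ideal_powSP (finite_mod2 F) q2 unif.
have [piq uq tau_pi tau_int] := unif.
move=> e2 d_nsq; have [j [x [j_lt xk xk']]] := nonsquare_exponent e2 d_nsq.
have [L _ [s sroot sfull]] :
    {L : fieldExtType F & \dim {:L} = (size ('X^2 - (int_val d)%:P : {poly F})).-1 &
    {z | root (map_poly (in_alg L) ('X^2 - (int_val d)%:P)) z & <<1; z>>%VS = fullv}}.
  apply: irredp_FAdjoin; apply: cubic_irreducible; first by rewrite size_XnsubC.
  move=> s; rewrite rootE !hornerE; apply/eqP => sd.
  have [|s' s'E] := @integral_quadratic _ 0 (- d) s.
    by rewrite int_val0 mul0r addr0 int_valN.
  apply: (d_nsq s'); have -> : d - s' ^+ 2 = 0; last exact: ideal_pow_zero.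
  apply: int_val_inj; rewrite int_valD int_valN int_valX s'E int_val0.
  by rewrite -[RHS]oppr0 -sd opprB.
have s2 : s ^+ 2 = emb L (int_val d).
  move: sroot; rewrite rootE rmorphB rmorphXn /= map_polyX map_polyC.
  by rewrite hornerD hornerN hornerC hornerXn subr_eq0 => /eqP.
exists L; split; first by exists s.
have [P Pq] := lying_over L q2.
apply: (ramifies_in_above2 q2 Pq).
have /pwP[g gE] : pw j 2 by apply: ideal_powW e2; apply: ltnW.
have gq : g \in q by apply/(pwSP _ _ _ gE); apply: ideal_powW e2.
have /pwP[c cE] : pw j.*2 (d - x ^+ 2) by apply: ideal_powSW.
have cq : c \in q by apply/(pwSP _ _ _ cE).
have /pwP[c' c'E] := xk.
have c'q : c' \notin q by apply/negP => /(pwSP _ _ _ c'E).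
pose beta := emb L tau ^+ j * (s - emb L (int_val x)).
have betaE : beta ^+ 2 + emb L (int_val g * int_val x) * beta -
    emb L (int_val c) = 0.
  rewrite gE cE !(int_valD, int_valN, int_valX).
  rewrite !(embM, embX, embD, embN) emb1 -s2 -addnn exprD /beta.
  by ring.
have [|z zE] := @integral_quadratic L (int_ext L (g * x)) (- int_ext L c) beta.
  exact: betaE.
have z2 : int_ext L c = z * z + int_ext L (g * x) * z.
  apply: int_val_inj; apply/eqP; rewrite eq_sym -subr_eq0; apply/eqP.
  by rewrite -[RHS]betaE -zE.
have gxP : int_ext L (g * x) \in P by rewrite Pq mulrC idealMr.
have zP : z \in P.
  apply: (@prime_idealrX _ P 2).
  have -> : z ^+ 2 = int_ext L c - z * int_ext L (g * x) by rewrite z2; ring.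
  by rewrite rpredB ?Pq // idealMr.
have cP2 : ideal_pow [set` P] 2 (int_ext L c).
  rewrite z2; apply: ideal_powD; apply: ideal_powM1 => //; exact/ideal_pow1.
move=> y /tau_int[y' y'E].
apply: (@ideal_pow_primary _ P (above_max q2 Pq) 2 (int_ext L c')).
  by rewrite Pq.
have -> : int_ext L c' * int_ext L y = int_ext L y' * int_ext L c.
  rewrite -!int_extM; congr (int_ext L _); apply: int_val_inj.
  by rewrite !int_valM y'E cE c'E exprS; ring.
exact: ideal_powM.
Qed.

Section Unramified.
Variable L : fieldExtType F.
Local Notation ext := (int_ext L).
Local Notation emb := (emb L).

Lemma sub1v_emb (v : L) : v \in 1%VS -> exists a : F, v = emb a.
Proof. by move=> /vlineP[a ->]; exists a. Qed.

Lemma emb_in1 (a : F) : emb a \in 1%VS.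
Proof. by apply/vlineP; exists a. Qed.

Lemma emb_free (s : L) (a b : F) : s \notin 1%VS -> emb a + emb b * s = 0 ->
  a = 0 /\ b = 0.
Proof.
move=> s1 abs; have b0 : b = 0.
  apply/eqP; apply: contraNT s1 => b0.
  suff -> : s = emb (- a / b) by apply: emb_in1.
  apply: (@mulfI _ (emb b)); first by rewrite emb_eq0.
  rewrite -embM mulrCA divff // mulr1 embN.
  by apply/eqP; rewrite -subr_eq0 opprK addrC abs.
move: abs; rewrite b0 emb0 mul0r addr0 => /eqP; rewrite emb_eq0 => /eqP->.
by [].
Qed.

(** In [F(sqrt d)] every element is of the form [a + b * sqrt d]. *)
Lemma quadratic_coords (s : L) (d : F) : s ^+ 2 = emb d ->
  <<1; s>>%VS = fullv -> forall v : L, exists a b : F, v = emb a + emb b * s.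
Proof.
move=> s2 sfull v.
have /Fadjoin_polyP[p /polyOverP p1 ->] : v \in <<1; s>>%VS.
  by rewrite sfull memvf.
rewrite horner_coef.
apply: (big_ind (fun v => exists a b : F, v = emb a + emb b * s)) => [|x y|i _].
- by exists 0, 0; rewrite emb0 mul0r addr0.
- move=> [a [b ->]] [a' [b' ->]]; exists (a + a'), (b + b').
  by rewrite !embD; ring.
have /sub1v_emb[c ->] := p1 i.
have [a [b ->]] : exists a b : F, s ^+ i = emb a + emb b * s.
  elim: (i : nat) => [|k [a [b kE]]].
    by exists 1, 0; rewrite emb0 emb1 mul0r addr0.
  exists (b * d), a; rewrite exprS kE embM -s2; ring.
by exists (c * a), (c * b); rewrite !embM; ring.
Qed.

(** The conjugation that exchanges the roots [s] and [- t - s] of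
    [X ^+ 2 + t * X - c] preserves integrality. *)
Lemma conjugate_int (s : L) (t c a b : F) (z : 'O_L) : s \notin 1%VS ->
  s ^+ 2 = emb c - emb t * s -> int_val z = emb a + emb b * s ->
  exists z' : 'O_L, int_val z' = emb a + emb b * (- emb t - s).
Proof.
move=> s1 s2 zE; set w := emb a + emb b * (- emb t - s).
have conj (p : {poly int}) : exists A B : F,
    (map_poly intr p).[int_val z] = emb A + emb B * s /\
    (map_poly intr p).[w] = emb A + emb B * (- emb t - s).
  elim/poly_ind: p => [|p n [A [B [pz pw]]]].
    by exists 0, 0; rewrite rmorph0 !horner0 emb0 !mul0r addr0.
  exists (A * a + B * b * c + n%:~R), (A * b + B * a - B * b * t).
  have -> : map_poly (intr : int -> L) (p * 'X + n%:P) =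
          map_poly intr p * 'X + (n%:~R)%:P.
    by rewrite rmorphD rmorphM /= map_polyX map_polyC.
  have nE : emb n%:~R = n%:~R by apply: rmorph_int.
  rewrite !hornerD !hornerC !hornerMX pz pw zE /w !(embD, embM, embN) nE.
  have cE : emb c = s ^+ 2 + emb t * s by rewrite s2; ring.
  by rewrite cE; split; ring.
have w_int : w \in @integral_elt L.
  have /asboolP[p p_mon pz0] := int_valP z.
  apply/asboolP; exists p => //; move: pz0; rewrite /root.
  have [A [B [-> ->]]] := conj p.
  move=> /eqP/(emb_free s1)[-> ->].
  by rewrite emb0 mul0r addr0.
by exists (RingOfIntegers w_int).
Qed.

(** The discriminant [t ^+ 2 + 4 * c] of [X ^+ 2 + t * X - c] clears the
    denominators of the coordinates of the integers of [L] with respect to 1 and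
    a root [z], because the traces of [y] and [y * z] are integral.  When [L] is
    [F] itself, the second coordinate can be taken to be 0. *)
Lemma discriminant_coords (s : L) (d : F) (t c : 'O_F) (z : 'O_L) :
    s ^+ 2 = emb d -> <<1; s>>%VS = fullv -> (s \notin 1%VS -> int_val z \notin 1%VS) ->
    (exists k m : F, s = emb k * int_val z + emb m) ->
    z ^+ 2 = ext c - ext t * z ->
  forall y : 'O_L, exists a b : 'O_F,
    ext (t ^+ 2 + 4 * c) * y = ext a + ext b * z.
Proof.
move=> s2 sfull sz [k [m sE]] z2 y.
have [s1|/sz z1] := boolP (s \in 1%VS).
  have [v yE] : exists v : F, int_val y = emb v.
    apply: sub1v_emb; have := memvf (int_val y); rewrite -sfull.
    by rewrite (Fadjoin_idP s1).
  have [y' [_ <-]] := int_descend yE.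
  exists ((t ^+ 2 + 4 * c) * y'), 0; rewrite int_extM (int_ext_nat _ 0) mul0r addr0.
  by [].
have [a [b yE]] : exists a b : F, int_val y = emb a + emb b * int_val z.
  have [a [b ->]] := quadratic_coords s2 sfull (int_val y).
  by exists (a + b * m), (b * k); rewrite sE !(embD, embM); ring.
have zz2 : int_val z ^+ 2 = emb (int_val c) - emb (int_val t) * int_val z.
  by rewrite -int_valX z2.
have [y' y'E] := conjugate_int z1 zz2 yE.
pose z' := - ext t - z.
have tE : int_val (y + y') = emb (2 * a - int_val t * b).
  by rewrite int_valD yE y'E !(embD, embM, embN) ?emb1; ring.
have nE : int_val (y * z + y' * z') =
    emb (- int_val t * a + (int_val t ^+ 2 + 2 * int_val c) * b).
  rewrite int_valD !int_valM yE y'E /z' int_valD !int_valN int_val_ext.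
  have -> : emb (- int_val t * a + (int_val t ^+ 2 + 2 * int_val c) * b) =
    - emb (int_val t) * emb a + (emb (int_val t) ^+ 2 + 2 * emb (int_val c)) * emb b.
    by rewrite !(embD, embM, embN, embX) emb1.
  have -> : emb (int_val c) = int_val z ^+ 2 + emb (int_val t) * int_val z.
    by rewrite zz2; ring.
  by ring.
have [T1 [T1E _]] := int_descend tE.
have [T2 [T2E _]] := int_descend nE.
exists ((t ^+ 2 + 2 * c) * T1 + t * T2), (2 * T2 + t * T1).
apply: int_val_inj; rewrite !(int_valM, int_valD) !int_val_ext yE.
rewrite !(int_valM, int_valD, int_valX) !int_val1 T1E T2E.
rewrite !(embD, embM, embN, embX) !emb1.
by ring.
Qed.

End Unramified.

(** If [q] is contained in the square of [P] above it, then every element of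
    [P] is, up to units at [P] and modulo the square of [P], the square of an
    element of [P]: the order [O_F + O_F * z] is etale at [q] and its reduction
    is therefore perfect.  Hence [P] equals its square. *)
Lemma square_unramified d x e : pw e 2 -> ~ pw e.+1 2 -> d \notin q ->
  pw (2 * e) (d - x ^+ 2) -> ~ ramifies_in_sqrt q (int_val d).
Proof.
have [tau [pi [u unif]]] := uniformizing_exists (finite_mod2 F) F2 q2.
have pwP := ideal_powP (finite_mod2 F) q2 unif.
have pwSP := ideal_powSP (finite_mod2 F) q2 unif.
have [piq uq tau_pi tau_int] := unif.
move=> e2 e2' dq xd [L [[s s2 sfull] [P [e' [Pq [IP _] e'1]]]]].
have qP2 y : y \in q -> ideal_pow [set` P] 2 (int_ext L y).
  by move=> yq; apply: (ideal_powW e'1); apply: IP; apply: ext_ideal_in.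
have tau0 : tau != 0.
  apply: contraNneq uq => tau0.
  suff -> : u = 0 by rewrite idealr0.
  by apply: int_val_inj; rewrite -tau_pi tau0 mul0r.
have e_gt0 : (0 < e)%N 
  by rewrite lt0n; apply/eqP => e0; apply: e2'; rewrite e0; apply/ideal_pow1.
have xq : x \notin q.
  apply: contra dq => xq; rewrite -[d](subrK (x ^+ 2)) rpredD //.
    by apply/ideal_pow1; apply: ideal_powW xd; lia.
  by rewrite expr2 idealMr.
have /pwP[g gE] := e2.
have gq : g \notin q by apply/negP => /(pwSP _ _ _ gE).
have /pwP[c cE] := xd; pose t := g * x.
have tq : t \notin q by rewrite prime_idealrM negb_or gq.
pose beta := emb L tau ^+ e * (s - emb L (int_val x)).
have betaE : beta ^+ 2 + emb L (int_val t) * beta - emb L (int_val c) = 0.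
  rewrite int_valM gE cE !(int_valD, int_valN, int_valX).
  rewrite !(embM, embX, embD, embN) emb1 -[emb L (int_val d)]s2 mul2n -addnn exprD /beta.
  by ring.
have [|z zE] := @integral_quadratic L (int_ext L t) (- int_ext L c) beta.
  exact: betaE.
have z2 : z ^+ 2 = int_ext L c - int_ext L t * z.
  apply: int_val_inj; apply/eqP; rewrite -subr_eq0; apply/eqP.
  have -> : int_val (z ^+ 2) - int_val (int_ext L c - int_ext L t * z) =
    beta ^+ 2 - (emb L (int_val c) - emb L (int_val t) * beta) by rewrite -zE.
  by rewrite -[RHS]betaE; ring.
have sE : s = emb L (tau ^- e) * int_val z + emb L (int_val x).
  by rewrite zE /beta mulrA -embX -embM mulVf ?expf_neq0 // emb1 mul1r subrK.
have s1z1 : s \notin 1%VS -> int_val z \notin 1%VS.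
  apply: contra => /sub1v_emb[v zv].
  by rewrite sE zv -embM -embD emb_in1.
pose D := t ^+ 2 + 4 * c.
have Dq : D \notin q.
  apply: contra tq => Dq; apply: (@prime_idealrX _ q 2).
  have -> : t ^+ 2 = D - 2 * (2 * c) by rewrite /D; ring.
  by rewrite rpredB // even_in.
have PP2 : [set` P] `<=` ideal_pow [set` P] 2.
  move=> y yP.
  apply: (@ideal_pow_primary _ P (above_max q2 Pq) 2 (int_ext L D)).
    by rewrite Pq.
  have [|a [b DyE]] := discriminant_coords s2 sfull s1z1 _ z2 y.
    by exists (tau ^- e), (int_val x).
  have [t' tt'] := q_max tq.
  have [b' bb'] := square_mod (finite_mod2 F) q2 (- b * t').
  have [a' aa'] := square_mod (finite_mod2 F) q2 (a - b' ^+ 2 * c).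
  have bq : b + t * b' ^+ 2 \in q.
    have -> : b + t * b' ^+ 2 = b * (1 - t * t') - t * (- b * t' - b' ^+ 2) by ring.
    by rewrite rpredB // idealMr.
  pose w := int_ext L a' + int_ext L b' * z.
  have wE : int_ext L a + int_ext L b * z = w ^+ 2 +
      (int_ext L (a - b' ^+ 2 * c - a' ^+ 2) + z * int_ext L (b + t * b' ^+ 2) -
       (int_ext L a' * int_ext L b' * z) * int_ext L 2).
    have -> : w ^+ 2 = int_ext L a' * int_ext L a' +
        2 * int_ext L a' * int_ext L b' * z + int_ext L b' * int_ext L b' * z ^+ 2.
      by rewrite /w; ring.
    rewrite z2 expr2 !(int_extD, int_extN, int_extM) (int_ext_nat _ 1); ring.
  set r := (X in w ^+ 2 + X) in wE.
  have rP2 : ideal_pow [set` P] 2 r.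
    by apply: ideal_powB; [apply: ideal_powD; [|apply: ideal_powM]
                          |apply: ideal_powM]; apply: qP2.
  have wP : w \in P.
    apply: (@prime_idealrX _ P 2); rewrite -[w ^+ 2](addrK r) -wE.
    rewrite rpredB ?(ideal_powS_in rP2) //.
    by rewrite -DyE idealMr.
  rewrite DyE wE; apply: ideal_powD => //.
  exact: ideal_powX.
have [M M2] := two_notin_above q2 Pq.
have PM k : (0 < k)%N -> [set` P] `<=` ideal_pow [set` P] k.
  case: k => // k _; elim: k => [|k IHk] v vP; first exact/ideal_pow1.
  move/PP2: vP; move: v; apply: ideal_powS_ind => [|v w|v w vP /ideal_pow1 wP].
  - exact: ideal_pow_zero.
  - exact: ideal_powD.
  - by apply: ideal_powM1 => //; apply: IHk.
apply: M2; case: M => // M; apply: PM => //; exact: (two_in_above q2 Pq).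
Qed.

End Quadratic.

(** * Quadratic characters *)

Section Characters.
Variables (R : comNzRingType) (p : prime_idealr R).
Hypothesis p_max : forall s, s \notin p -> exists t, 1 - s * t \in p.
Implicit Types (x y s t g h : R).
Local Notation pw := (ideal_pow [set` p]).

Section Separation.
Variables (N : nat) (g : R).
Hypotheses (N_gt0 : (0 < N)%N) (gp : g \notin p).
Hypothesis g_nsq : forall x, ~ pw N (g - x ^+ 2).

Let pwN_in x : pw N x -> x \in p.
Proof. by case: N N_gt0 => // n _; apply: ideal_powS_in. Qed.

Let pwN_unit x y : x \notin p -> pw N (x - y) -> y \notin p.
Proof.
move=> xp /pwN_in xy; apply: contra xp => yp.
by rewrite -[x](subrK y) rpredD.
Qed.

Let mul_unit x y : x \notin p -> y \notin p -> x * y \notin p.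
Proof. by rewrite prime_idealrM negb_or => -> ->. Qed.

(** Preimage of a group of invertible classes modulo [p ^+ N] that avoids the
    class of [g] and, unless it is empty, contains all squares. *)
Definition avoiding (A : set R) : Prop :=
  [/\ (forall x, A x -> x \notin p) /\ (forall x y, A x -> A y -> A (x * y)),
      forall x y, A x -> pw N (x - y) -> A y,
      forall s x, s \notin p -> A x -> A (s ^+ 2 * x)
    & ~ A g].

Lemma avoiding_squares :
  avoiding [set x | exists2 s, s \notin p & pw N (x - s ^+ 2)].
Proof.
split=> [|x y [s sp xs] xy|s x sp [t tp xt]|[s _]]; last exact: g_nsq.
- split=> [x [s sp xs]|x y [s sp xs] [t tp yt]].
    apply: (pwN_unit (prime_idealrXn 2 sp)).
    by rewrite -opprB; apply: ideal_powN.
  exists (s * t); first exact: mul_unit.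
  have -> : x * y - (s * t) ^+ 2 = x * (y - t ^+ 2) + t ^+ 2 * (x - s ^+ 2) by ring.
  by apply: ideal_powD; apply: ideal_powM.
- exists s => //; have -> : y - s ^+ 2 = (x - s ^+ 2) - (x - y) by ring.
  exact: ideal_powB.
- exists (s * t); first exact: mul_unit.
  have -> : s ^+ 2 * x - (s * t) ^+ 2 = s ^+ 2 * (x - t ^+ 2) by ring.
  exact: ideal_powM.
Qed.

Lemma maximal_avoiding : exists A, [/\ avoiding A, exists x, A x &
  forall B, avoiding B -> A `<=` B -> B `<=` A].
Proof.
have [|A [Ag Amax]] := @Zorn_bigcup _ avoiding.
  move=> C Cgood Ctot; split=> [|x y [A CA Ax] xy|s x sp [A CA Ax]|[A CA Ag]].
  - split=> [x [A CA Ax]|x y [A CA Ax] [B CB By]].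
      by have [[Ap _] _ _ _] := Cgood A CA; apply: Ap.
    have [AB|BA] := Ctot A B CA CB.
      by exists B => //; have [[_ BM] _ _ _] := Cgood B CB; apply: BM => //; apply: AB.
    by exists A => //; have [[_ AM] _ _ _] := Cgood A CA; apply: AM => //; apply: BA.
  - by exists A => //; have [_ Ac _ _] := Cgood A CA; apply: Ac xy.
  - by exists A => //; have [_ _ As _] := Cgood A CA; apply: As.
  - by have [_ _ _ Ag'] := Cgood A CA.
exists A; split=> // [|B Bg AB].
  apply: contrapT => A_empty; apply: (Amax _ _ avoiding_squares).
  split=> [x Ax|SA]; first by case: A_empty; exists x.
  apply: A_empty; exists 1; apply: SA; exists 1; first by rewrite idealr1.
  by rewrite expr1n subrr; apply: ideal_pow_zero.
by apply: contrapT => BA; apply: (Amax B _ Bg).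
Qed.

(** A nonsquare class is detected by a character of order 2: a maximal
    subgroup containing the squares and avoiding [g] has index 2. *)
Lemma sign_char_separates : exists chi, sign_char (pw N) chi /\ chi g = -1.
Proof.
have [A [[[Ap AM] Ac As Ag] [x0 Ax0] Amax]] := maximal_avoiding.
have Acancel s x : s \notin p -> A (s ^+ 2 * x) -> A x.
  move=> sp Asx; have [t st] := inv_mod_pow p_max N sp.
  have tp : t \notin p.
    apply/negP => tp; move: (idealr1 p).
    have -> : 1 = (1 - s * t) + s * t by ring.
    by rewrite rpredD //; [apply: pwN_in|apply: idealMr].
  apply: (Ac (t ^+ 2 * (s ^+ 2 * x))); first exact: As.
  have -> : t ^+ 2 * (s ^+ 2 * x) - x = - (x * (1 + s * t)) * (1 - s * t) by ring.
  exact: ideal_powM.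
have A1 : A 1.
  by apply: (Acancel x0); [exact: Ap|rewrite mulr1 expr2; apply: AM].
have index2 x : x \notin p -> ~ A x -> A (g * x).
  move=> xp Ax; pose B : set R := [set y | A y \/ exists2 h, A h & pw N (h * x - y)].
  have [h Ah gh] : exists2 h, A h & pw N (h * x - g).
    apply: contrapT => no_h; apply: Ax; apply: (Amax B); last 2 first.
    - by move=> y Ay; left.
    - by right; exists 1 => //; rewrite mul1r subrr; apply: ideal_pow_zero.
    split=> [|y z [Ay|[h Ah hy]] yz|s y sp [Ay|[h Ah hy]]|[//|//]].
    - have Bp y : B y -> y \notin p.
        case=> [/Ap//|[h Ah hy]]; apply: pwN_unit hy.
        by apply: mul_unit => //; apply: Ap.
      split=> // y z [Ay|[h Ah hy]] [Az|[k Ak kz]].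
      + by left; apply: AM.
      + right; exists (y * k); first exact: AM.
        have -> : y * k * x - y * z = y * (k * x - z) by ring.
        exact: ideal_powM.
      + right; exists (h * z); first exact: AM.
        have -> : h * z * x - y * z = z * (h * x - y) by ring.
        exact: ideal_powM.
      + left; apply: (Ac (x ^+ 2 * (h * k))); first by apply: As => //; apply: AM.
        have -> : x ^+ 2 * (h * k) - y * z = k * x * (h * x - y) + y * (k * x - z) by ring.
        by apply: ideal_powD; apply: ideal_powM.
    - by left; apply: Ac yz.
    - right; exists h => //; have -> : h * x - z = (h * x - y) + (y - z) by ring.
      exact: ideal_powD.
    - by left; apply: As.
    - right; exists (s ^+ 2 * h); first exact: As.
      have -> : s ^+ 2 * h * x - s ^+ 2 * y = s ^+ 2 * (h * x - y) by ring.
      exact: ideal_powM.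
  apply: (Ac (x ^+ 2 * h)); first exact: As.
  have -> : x ^+ 2 * h - g * x = x * (h * x - g) by ring.
  exact: ideal_powM.
pose chi x : int := if x \in p then 0 else if `[< A x >] then 1 else -1.
have unitN x : unit_mod (pw N) x <-> x \notin p.
  by case: N N_gt0 => // n _; apply: unit_modP.
have chiA x : A x -> chi x = 1.
  by move=> Ax; rewrite /chi (negPf (Ap _ Ax)) asboolT.
have chiNA x : x \notin p -> ~ A x -> chi x = -1.
  by move=> xp Ax; rewrite /chi (negPf xp) asboolF.
exists chi; split; last exact: chiNA.
split.
- move=> x y xy; have yx : pw N (y - x) by rewrite -opprB; apply: ideal_powN.
  rewrite /chi; have -> : (x \in p) = (y \in p).
    by apply/idP/idP; apply: contraLR => h; [apply: pwN_unit h yx|apply: pwN_unit h xy].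
  case: ifP => // _; congr (if _ then _ else _).
  by apply: asbool_equiv_eq; split=> /Ac; apply.
- by move=> x /unitN/negP; rewrite negbK /chi => ->.
- by move=> x /unitN xp; rewrite /chi (negPf xp); case: ifP; [left|right].
move=> x y /unitN xp /unitN yp; have xyp := mul_unit xp yp.
have [Ax|Ax] := pselect (A x); have [Ay|Ay] := pselect (A y).
- by rewrite !chiA //; apply: AM.
- rewrite (chiA x) // !chiNA // => Axy; apply: Ay; apply: (Acancel x) => //.
  by rewrite expr2 -mulrA; apply: AM.
- rewrite (chiA y) // !chiNA // => Axy; apply: Ax; apply: (Acancel y) => //.
  by rewrite expr2 -mulrA [y * x]mulrC; apply: AM.
- rewrite (chiNA x) // (chiNA y) // chiA //; apply: (Acancel g) => //.
  have -> : g ^+ 2 * (x * y) = (g * x) * (g * y) by ring.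
  by apply: AM; apply: index2.
Qed.

End Separation.

(** The conductor of the separating character is at least 2 because every
    class modulo [p] is a square. *)
Lemma primitive_char_separates N g : (0 < N)%N -> g \notin p ->
    (forall x, exists y, x - y ^+ 2 \in p) ->
    (forall x, ~ pw N (g - x ^+ 2)) ->
  exists n chi, [/\ (2 <= n <= N)%N, quadratic_char (pw n) chi,
    primitive_char p n chi & chi g = -1].
Proof.
move=> N_gt0 gp p_sq g_nsq.
have [chi0 [chi0_sign chi0g]] := sign_char_separates N_gt0 gp g_nsq.
pose P n := `[< factors_through (pw N) (pw n) chi0 >].
have exP : exists n, P n by exists N; apply/asboolP; exists chi0.
case: (ex_minnP exP) => n /asboolP[chi chi_sign chi0E] n_min.
have unitN x : unit_mod (pw N) x <-> x \notin p.
  by case: N N_gt0 {g_nsq chi0_sign P exP chi0E n_min} => // m _; apply: unit_modP.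
have chig : chi g = -1 by rewrite -chi0E //; apply/unitN.
have [chi_eq chi0' chi_pm chiM] := chi_sign.
have n_ge2 : (2 <= n)%N.
  case: n chi_sign chi0E n_min chi_eq chi0' chi_pm chiM => [|[|//]] _ _ _ chi_eq _ chi_pm chiM.
    (* modulo the unit ideal, [chi] is constant and multiplicative *)
    have u1 : unit_mod (pw 0) (1 : R) by exists 1.
    have := chiM 1 1 u1 u1; rewrite (chi_eq (1 * 1) g) // (chi_eq 1 g) // chig.
    by [].
  (* modulo [p], the element [g] is a square *)
  have [y gy] := p_sq g.
  have yp : y \notin p.
    apply: contra gp => yp; rewrite -[g](subrK (y ^+ 2)) rpredD //.
    by rewrite expr2 idealMr.
  have uy : unit_mod (pw 1) y by apply/unit_modP.
  have := chiM y y uy uy; rewrite -expr2 -(chi_eq g (y ^+ 2)); last exact/ideal_pow1.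
  by rewrite chig; case: (chi_pm y uy) => ->.
have unitn x : unit_mod (pw n) x <-> x \notin p.
  by case: n n_ge2 {n_min chi_sign chi0E chi_eq chi0' chi_pm chiM} => // m _; apply: unit_modP.
exists n, chi; split=> //.
- by rewrite n_ge2; apply/n_min/asboolP; exists chi0.
- by split=> //; exists g; [apply/unitn|rewrite chig].
- move=> m m_lt [psi psi_sign psiE].
  suff: (n <= m)%N by rewrite leqNgt m_lt.
  apply/n_min/asboolP; exists psi => // x xu; rewrite chi0E // psiE //.
  by apply/unitn/unitN.
Qed.

End Characters.

(** * The valuation at a prime above 2 *)

Section Valuation.
Variables (F : fieldExtType rat) (q : prime_idealr 'O_F).
Hypothesis q2 : 2 \in q.
Implicit Types (a b : 'O_F).
Local Notation pw := (ideal_pow [set` q]).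

Lemma exponent_unique a i j :
  pw i a -> ~ pw i.+1 a -> pw j a -> ~ pw j.+1 a -> i = j.
Proof.
have le k l : ~ pw k.+1 a -> pw l a -> (l <= k)%N.
  by move=> ak al; rewrite leqNgt; apply/negP => kl; apply: ak; apply: ideal_powW al.
by move=> ai ai' aj aj'; apply/eqP; rewrite eqn_leq !le.
Qed.

Lemma val_q_exact a k : pw k a -> ~ pw k.+1 a -> val_q q (int_val a) = k%:Z.
Proof.
have [tau [pi [u unif]]] :=
  uniformizing_exists (finite_mod2 F) (two_neq0 F) q2.
move=> ak ak'; apply: xget_unique.
  exists a, 1, k, 0%N; split; last by rewrite subr0.
  - by rewrite int_val1 mulr1.
  - by split; [apply/ideal_span_subP|move=> /ideal_span_subP].
  - by split=> // /ideal_span_subP/ideal_pow1; rewrite idealr1.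
move=> m [a' [b [i [j [abK [a'i a'i'] [bj bj'] ->]]]]].
have abE : a * b = a' by apply: int_val_inj.
move/ideal_span_subP in a'i; move/ideal_span_subP in bj.
have {}a'i' : ~ pw i.+1 a' by move=> /ideal_span_subP.
have {}bj' : ~ pw j.+1 b by move=> /ideal_span_subP.
rewrite -abE in a'i a'i'.
have -> : i = (k + j)%N.
  apply: (exponent_unique a'i a'i'); first exact: ideal_powMD.
  exact: (ideal_pow_notM (finite_mod2 F) q2 unif).
by rewrite PoszD addrK.
Qed.

Lemma q_adic_unit_notin a : q_adic_unit q (int_val a) -> a \notin q.
Proof.
move=> [a0 va].
have [|k [ak ak']] :=
    nonzero_exponent (finite_mod2 F) (two_neq0 F) q2 (x := a).
  by apply: contraNneq a0 => ->; rewrite int_val0.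
have := val_q_exact ak ak'; rewrite va => -[k0]; subst k.
by apply/negP => /ideal_pow1.
Qed.

(** A congruence [1 + pi = x ^+ 2] modulo the square of [q] would make
    [x - 1] and [x + 1] elements of [q], and [pi] an element of its square. *)
Lemma nonsquare_unit_exists : exists g, g \notin q /\ forall x, ~ pw 2 (g - x ^+ 2).
Proof.
have [tau [pi [u unif]]] := uniformizing_exists (finite_mod2 F) (two_neq0 F) q2.
have [piq uq tau_pi _] := unif.
have pi2 : ~ pw 2 pi.
  move=> pi2; case/negP: uq.
  apply/(ideal_powSP (finite_mod2 F) q2 unif (k := 1) (x := pi)) => //.
exists (1 + pi); split=> [|x xpi].
  apply/negP => piq'; move: (idealr1 q).
  have -> : 1 = (1 + pi) - pi by ring.
  by rewrite rpredB.
have x1 : x - 1 \in q.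
  apply: (@prime_idealrX _ q 2).
  have -> : (x - 1) ^+ 2 = pi - (1 + pi - x ^+ 2) - 2 * (x - 1) by ring.
  by rewrite rpredB ?even_in // rpredB // (ideal_powS_in xpi).
apply: pi2; have -> : pi = (1 + pi - x ^+ 2) + (x - 1) * (x - 1 + 2) by ring.
apply: ideal_powD => //; apply: ideal_powM1 => //.
by apply/ideal_pow1; rewrite rpredD.
Qed.

End Valuation.

(** * Primitive quadratic characters and ramification *)

Theorem lemma2p10 (F : fieldExtType rat) (q : prime_idealr 'O_F)
    (q_dvd2 : 2 \in q) :
  let e : int := val_q q 2 in
  let good (n : nat) (chi : 'O_F -> int) (eps : int) : Prop :=
    [/\ (2 <= n)%N /\ n%:Z <= 2 * e + 1,
        quadratic_char (ideal_pow [set` q] n) chi,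
        primitive_char q n chi,
        eps = 1 \/ eps = -1
      & forall (xi : F) (two_xi : 'O_F), int_val two_xi = 2 * xi ->
          chi two_xi = eps -> ramifies_in_sqrt q (- (2 * xi))] in
  (exists (n : nat) (chi : 'O_F -> int) (eps : int), good n chi eps) /\
  (forall a0 : 'O_F,
     q_adic_unit q (int_val a0) -> ramifies_in_sqrt q (- int_val a0) ->
     exists (n : nat) (chi : 'O_F -> int) (eps : int),
       good n chi eps /\ chi a0 = eps).
Proof.
move=> valq good; have q_max := prime_above2_max (finite_mod2 F) q_dvd2.
have [e [e2 e2']] :=
  exact_exponent (two_notin_ideal_pow (finite_mod2 F) (two_neq0 F) q_dvd2).
have valE : valq = e by rewrite /valq -(int_val_nat F 2) (val_q_exact q_dvd2 e2 e2').
have e_gt0 : (0 < e)%N.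
  by rewrite lt0n; apply/eqP => e0; apply: e2'; rewrite e0; apply/ideal_pow1.
have main (g : 'O_F) : g \notin q ->
    (forall x, ~ ideal_pow [set` q] (2 * e) (g - x ^+ 2)) ->
    exists n chi eps, good n chi eps /\ chi (- g) = eps.
  move=> gq g_nsq.
  have [|n [chi [/andP[n2 ne] chi_quad chi_prim chig]]] :=
    primitive_char_separates q_max _ gq (square_mod (finite_mod2 F) q_dvd2) g_nsq.
    by rewrite muln_gt0.
  have [[chi_eq chi0 chi_pm chiM] _] := chi_quad.
  have unitn x : unit_mod (ideal_pow [set` q] n) x <-> x \notin q.
    by case: n n2 {ne chi_quad chi_prim chi_eq chi0 chi_pm chiM} => // m _; apply: unit_modP.
  have u1 : unit_mod (ideal_pow [set` q] n) (-1).
    by apply/unitn; rewrite rpredN idealr1.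
  have eps_pm := chi_pm _ u1.
  have chiN x : x \notin q -> chi (- x) = chi (-1) * chi x.
    by move=> /unitn xu; rewrite -(chiM _ _ u1 xu) mulN1r.
  exists n, chi, (- chi (-1)); split; last by rewrite chiN // chig mulrN1.
  split=> //.
  - by split=> //; rewrite valE; lia.
  - by case: eps_pm => ->; [right|left; rewrite opprK].
  move=> xi y yE chiy; rewrite -yE -int_valN.
  have yq : y \notin q.
    apply/negP => yq; have : chi y = 0 by apply: chi0 => /unitn; rewrite yq.
    by rewrite chiy; case: eps_pm => ->.
  apply: (nonsquare_ramifies q_dvd2 e2) => x yx.
  have chiNy : chi (- y) = -1.
    by rewrite chiN // chiy; case: eps_pm => ->.
  have yxn := ideal_powW ne yx.
  have xq : x \notin q.
    apply: contra yq => xq; rewrite -rpredN -[- y](subrK (x ^+ 2)) rpredD //.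
      by apply/ideal_pow1; apply: ideal_powW yxn; apply: ltnW.
    by rewrite expr2 idealMr.
  have xu : unit_mod (ideal_pow [set` q] n) x by apply/unitn.
  move: chiNy; rewrite (chi_eq _ _ yxn) expr2 chiM //.
  by case: (chi_pm x xu) => ->.
split=> [|a0 a0_unit a0_ram].
  have [g [gq g_nsq]] := nonsquare_unit_exists q_dvd2.
  have [|n [chi [eps [chi_good _]]]] := main g gq.
    by move=> x /(ideal_powW (_ : (2 <= 2 * e)%N))/g_nsq; apply; rewrite leq_pmulr.
  by exists n, chi, eps.
have a0q : a0 \notin q := q_adic_unit_notin q_dvd2 a0_unit.
rewrite -[a0]opprK; apply: main; first by rewrite rpredN.
move=> x a0x; apply: (square_unramified q_dvd2 e2 e2' _ a0x); first by rewrite rpredN.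
by rewrite int_valN.
Qed.
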